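(* Let $K$ be a field and let $n\ge1$, $d\ge0$ be integers. Every minimal generating set $S\subset K[X_1,\dots,X_n]$ such that $\deg f\le d$ for all $f\in S$ satisfies $|S|\le\binom{n+d}{d}$. This bound is sharp whenever $|K|>d$ (in particular, whenever $K$ is infinite): for all $K,n,d$ with $|K|>d$ there exists a minimal generating set $S\subset K[X_1,\dots,X_n]$ with $\deg f\le d$ for all $f\in S$ and $|S|=\binom{n+d}{d}$.
   Context: A set $S\subset K[X_1,\dots,X_n]$ is called a minimal generating set if it is minimal with respect to set containment among generating sets of the ideal $(S)$ it generates; that is, no proper subset $S'\subsetneq S$ generates the ideal $(S)$. Degree means total degree. *)

(* Defs.v *)
From mathcomp Require Import all_boot all_order all_algebra.
From mathcomp Require Import mpoly.
From mathcomp Require Import boolp classical_sets functions cardinality.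

Set Implicit Arguments.
Unset Strict Implicit.
Unset Printing Implicit Defensive.

Import GRing.Theory.
Local Open Scope ring_scope.
Local Open Scope classical_set_scope.

(* Unlike [idealr_closed], this allows the unit ideal and needs no
   decidability. *)
Definition is_ideal (R : comNzRingType) (I : set R) : Prop :=
  [/\ I 0,
      forall f g, I f -> I g -> I (f + g)
    & forall a f, I f -> I (a * f)].

Definition ideal_gen (R : comNzRingType) (S : set R) : set R :=
  smallest (@is_ideal R) S.

Definition minimal_generating_set (R : comNzRingType) (S : set R) : Prop :=
  forall S' : set R, S' `<` S -> ideal_gen S' <> ideal_gen S.

(* [msize f] is one more than the total degree of [f] when [f != 0], and
   [msize 0 = 0], so the zero polynomial has degree at most every [d]. *)
Definition degrees_le (K : fieldType) (n d : nat) (S : set {mpoly K[n]}) :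
    Prop :=
  forall f, S f -> (msize f <= d.+1)%N.

(* Main.v *)
(* Upper bound: a member of a minimal generating set is never in the ideal
   generated by the other members, so such a set is linearly independent inside
   the space of polynomials of degree at most [d], which is spanned by
   [binomial (n + d) d] monomials.
   Sharpness: pick distinct scalars [a 0, ..., a d] and consider the points
   [(a m_1, ..., a m_n)] with [m_1 + ... + m_n <= d]. The evaluation of the
   Newton polynomials [\prod_i \prod_(j < m_i) ('X_i - a j)] at these points is a
   triangular invertible matrix, so the points admit a dual basis of polynomials
   of degree at most [d]. Each of these is nonzero at a point where all the
   others vanish, so none is in the ideal generated by the others. *)
Require Import Defs.
From mathcomp Require Import all_boot all_order all_algebra.
From mathcomp Require Import mpoly.
From mathcomp Require Import boolp classical_sets functions cardinality.

Set Implicit Arguments.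
Unset Strict Implicit.
Unset Printing Implicit Defensive.

Import GRing.Theory.
Local Open Scope ring_scope.
Local Open Scope classical_set_scope.
Local Open Scope card_scope.

(** * Generated ideals and minimality *)

Section Ideals.
Variable R : comNzRingType.
Implicit Types S : set R.

Lemma ideal_gen_is_ideal S : is_ideal (ideal_gen S).
Proof.
split=> [I [[]]//|f g Sf Sg I|a f Sf I] SI; have [[_ ID IM] _] := SI.
  exact: ID (Sf I SI) (Sg I SI).
exact: IM (Sf I SI).
Qed.

Lemma sub_ideal_gen S : S `<=` ideal_gen S.
Proof. exact: sub_gen_smallest. Qed.

Lemma ideal_gen_min S I : is_ideal I -> S `<=` I -> ideal_gen S `<=` I.
Proof. exact: smallest_sub. Qed.

Lemma ideal_gen_sum S (I : Type) (r : seq I) (P : pred I) (c F : I -> R) :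
  (forall i, P i -> S (F i)) -> ideal_gen S (\sum_(i <- r | P i) c i * F i).
Proof.
move=> SF; have [I0 ID IM] := ideal_gen_is_ideal S.
apply: (big_ind (ideal_gen S)) => // i Pi.
by apply: IM; apply: sub_ideal_gen; apply: SF.
Qed.

(** If [f] lies in the ideal of the other members, removing it does not change the ideal.
    Conversely, a proper subset misses some [f] and hence sits inside [S] without [f]. *)
Lemma minimal_generating_setP S :
  minimal_generating_set S <-> forall f, S f -> ~ ideal_gen (S `\ f) f.
Proof.
split=> [minS f Sf Sff|minS S' [S'S /existsNP[f /not_implyP[Sf S'f]]] eqS'].
  apply: (minS (S `\ f)).
    by split=> [g []//|/(_ f Sf)[_]]; apply.
  apply/seteqP; split.
    by apply: ideal_gen_min (ideal_gen_is_ideal S) _ => g [/sub_ideal_gen].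
  apply: ideal_gen_min (ideal_gen_is_ideal _) _ => g Sg.
  by have [->//|/eqP ngf] := eqVneq g f; apply: sub_ideal_gen.
apply: (minS f Sf); suff: ideal_gen S' `<=` ideal_gen (S `\ f).
  by apply; rewrite eqS'; exact: sub_ideal_gen.
apply: ideal_gen_min (ideal_gen_is_ideal _) _ => g S'g.
apply: sub_ideal_gen; split; first exact: S'S.
by move=> /= gf; apply: S'f; rewrite -gf.
Qed.

End Ideals.

(** * Cardinals and counting of exponents *)

Lemma ord_card_leP T (A : set T) n :
  (`I_n #<= A) <-> exists2 f : 'I_n -> T, injective f & forall i, A (f i).
Proof.
rewrite (card_le_eql card_II); split.
  move=> /card_leP[g].
  exists (fun i => val (g (to_setT i))) => [i j /val_inj|i].
    move=> /(@inj _ _ _ g); rewrite !in_setT => /(_ isT isT) /(congr1 val).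
    exact.
  by apply/set_mem; exact: valP.
move=> [f finj Af]; rewrite -(card_le_eql (inj_card_eq (f := f) _)).
  by apply: subset_card_le => _ [i _ <-].
by move=> i j _ _ /finj.
Qed.

Lemma not_card_le_ord T (A : set T) n : ~ (A #<= `I_n) -> `I_n.+1 #<= A.
Proof.
move=> nAn; have [/finite_setP[m Am]|/infiniteP infA] := pselect (finite_set A).
  move: nAn; rewrite (card_le_eql Am) (card_le_eqr Am) !card_le_II.
  by move=> /negP; rewrite -ltnNge.
by apply: card_le_trans infA; exact: subset_card_le.
Qed.

Lemma card_bmultinom n d : #|{: 'X_{1..n < d.+1}}| = 'C(n + d, d).
Proof.
pose exps (m : 'X_{1..n < d.+1}) : n.-tuple 'I_d.+1 :=
  [tuple inord (m i) | i < n].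
(* Each exponent is at most the total degree, hence at most [d], so [inord] never falls back to its
   default. *)
have expsK m i : tnth (exps m) i = m i :> nat.
  rewrite tnth_mktuple inordK // (leq_ltn_trans _ (bmdeg m)) // mdegE.
  by rewrite (bigD1 i) //= leq_addr.
have exps_inj : injective exps.
  move=> m1 m2 eq12; apply/val_inj/mnmP => i.
  by rewrite -!expsK eq12.
transitivity 'C(n + d, n); last by rewrite -(bin_sub (leq_addr d n)) addKn.
rewrite -card_partial_ord_partitions -cardsT -(card_imset _ exps_inj).
apply: eq_card => t; rewrite inE; apply/imsetP/idP => [[m _ ->]|let_d].
  rewrite big_tuple (eq_bigr (fun i => m i : nat)) => [|i _]; last exact: expsK.
  by rewrite -mdegE -ltnS bmdeg.
pose mt : 'X_{1..n} := [multinom tnth t i : nat | i < n].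
have mt_d : (mdeg mt < d.+1)%N.
  rewrite ltnS (leq_trans _ let_d) // mdegE big_tuple leq_sum // => i _.
  by rewrite mnmE.
exists (BMultinom mt_d) => //; apply/eq_from_tnth => i; apply/val_inj => /=.
by rewrite expsK mnmE.
Qed.

Lemma lepm_mdeg_eq n (m k : 'X_{1..n}) :
  (m <= k)%MM -> (mdeg k <= mdeg m)%N -> m = k.
Proof.
move=> mk; rewrite -(submK mk) mdegD -{2}[mdeg m]add0n leq_add2r leqn0 mdeg_eq0.
by move=> /eqP ->; rewrite add0m.
Qed.

(** * Upper bound, dual families and degree estimates *)

Section Polynomials.
Variables (K : fieldType) (n : nat).
Implicit Type S : set {mpoly K[n]}.

(** The matrix of coefficients has one column per monomial of degree at most [d], hence more rows
    than columns, and its left kernel is nonzero. *)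
Lemma degrees_le_lin_dep d k (f : 'I_k -> {mpoly K[n]}) :
  (forall i, msize (f i) <= d.+1)%N -> ('C(n + d, d) < k)%N ->
  exists2 v : 'I_k -> K, \sum_i v i *: f i = 0 & exists i, v i != 0.
Proof.
move=> fd; rewrite -card_bmultinom => lt_k.
pose A := \matrix_(i < k, j < #|{: 'X_{1..n < d.+1}}|) (f i)@_(enum_val j).
have : kermx A != 0.
  by rewrite kermx_eq0 /row_free neq_ltn (leq_ltn_trans (rank_leq_col A) lt_k).
move=> /rowV0Pn[v /sub_kermxP vA0 /rV0Pn nz_v]; exists (v 0) => //.
have szf : (msize (\sum_i v 0 i *: f i) <= d.+1)%N.
  apply: leq_trans (msize_sum _ _ _) _; apply/bigmax_leqP => i _.
  exact: leq_trans (msizeZ_le _ _) (fd i).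
rewrite (mpolywE szf) big1 // => m _.
have := congr1 (fun w : 'rV_ _ => w 0 (enum_rank m)) vA0; rewrite !mxE.
under eq_bigr do rewrite mxE enum_rankK.
rewrite raddf_sum /= => vfm; under eq_bigr do rewrite mcoeffZ.
by rewrite vfm scale0r.
Qed.

Lemma minimal_generating_set_card_le d S :
  minimal_generating_set S -> degrees_le d S -> S #<= `I_('C(n + d, d)).
Proof.
move=> /minimal_generating_setP minS Sd; apply: contrapT.
move=> /not_card_le_ord/ord_card_leP[f f_inj Sf].
have [v vf0 [i nz_vi]] := degrees_le_lin_dep (fun i => Sd _ (Sf i)) (ltnSn _).
apply: (minS _ (Sf i)).
(* Dividing the relation by [v i] and reading scalars as constant polynomials puts [f i] in the
   ideal of the other members. *)
have fi_sum : f i = \sum_(j | j != i) (- (v j / v i))%:MP * f j.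
  apply: (scalerI nz_vi); move: vf0; rewrite (bigD1 i) //= => /eqP.
  rewrite addr_eq0 => /eqP ->; rewrite scaler_sumr -sumrN.
  apply: eq_bigr => j _.
  by rewrite mul_mpolyC scalerA mulrN mulrC divfK // scaleNr.
rewrite [X in ideal_gen _ X]fi_sum.
by apply: ideal_gen_sum => j ji; split=> // /f_inj/eqP; rewrite (negPf ji).
Qed.

Lemma dual_minimal_generating_set (I : finType) (pt : I -> 'I_n -> K)
    (L : I -> {mpoly K[n]}) :
  (forall i j, (L i).@[pt j] = (i == j)%:R) ->
  minimal_generating_set (range L) /\ (range L #= `I_#|I|).
Proof.
move=> Lpt; split.
  apply/minimal_generating_setP => _ [i _ <-] Li.
  have: (L i).@[pt i] = 0; last by move/eqP; rewrite Lpt eqxx oner_eq0.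
  (* The polynomials vanishing at [pt i] form an ideal that contains all the other members of the
     family. *)
  move: Li; apply: (ideal_gen_min (I := [set p | p.@[pt i] = 0])).
    split=> [|f g /= f0 g0|a f /= f0]; first exact: meval0.
      by rewrite mevalD f0 g0 addr0.
    by rewrite mevalM f0 mulr0.
  move=> _ [[j _ <-] /= Lij]; rewrite Lpt; case: eqVneq Lij => // -> //.
have L_inj : injective L.
  move=> i j Lij; apply/eqP; have := Lpt i j; rewrite Lij Lpt eqxx.
  by case: eqP => // _ /eqP; rewrite oner_eq0.
have -> : range L = range (L \o @enum_val I xpredT).
  apply/seteqP; split=> [_ [i _ <-]|_ [k _ <-]]; last by exists (enum_val k).
  by exists (enum_rank i) => //=; rewrite enum_rankK.
rewrite (card_eqr card_II); apply: inj_card_eq => i j _ _.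
by move=> /L_inj/enum_val_inj.
Qed.

Lemma msizeM_le_add (p q : {mpoly K[n]}) (a b : nat) :
  (msize p <= a.+1 -> msize q <= b.+1 -> msize (p * q) <= (a + b).+1)%N.
Proof.
have [->|nz_p] := eqVneq p 0; first by rewrite mul0r mmeasure0.
have [->|nz_q] := eqVneq q 0; first by rewrite mulr0 mmeasure0.
rewrite msizeM // => pa qb; rewrite -(leq_add2l 1) !add1n prednK.
  by rewrite (leq_trans (leq_add pa qb)) // addnS addSn.
by rewrite addn_gt0 lt0n mmeasure_poly_eq0 nz_p.
Qed.

Lemma msize_prod_le (I : Type) (r : seq I) (F : I -> {mpoly K[n]})
    (e : I -> nat) :
  (forall i, msize (F i) <= (e i).+1)%N ->
  (msize (\prod_(i <- r) F i) <= (\sum_(i <- r) e i).+1)%N.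
Proof.
move=> Fe; elim/big_rec2: _ => [|i a p _ pa]; first by rewrite msizeC leq_b1.
exact: msizeM_le_add.
Qed.

(** * Newton interpolation *)

Variables (d : nat) (a : nat -> K).
Hypothesis a_inj : {in [pred k | (k <= d)%N] &, injective a}.

Definition newton (m : 'X_{1..n}) : {mpoly K[n]} :=
  \prod_(i < n) \prod_(j < m i) ('X_i - (a j)%:MP).

Lemma msize_newton m : (msize (newton m) <= (mdeg m).+1)%N.
Proof.
rewrite mdegE; apply: msize_prod_le => i.
have := @msize_prod_le _ (index_enum 'I_(m i))
  (fun j : 'I_(m i) => 'X_i - (a j)%:MP) (fun=> 1%N).
rewrite sum1_card card_ord; apply => j.
rewrite (leq_trans (msizeD_le _ _)) // geq_max msizeX mdeg1 leqnn /=.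
by rewrite mmeasureN msizeC ltnW // ltnS leq_b1.
Qed.

(** The value is a product of differences [a (k i) - a j] with [j < m i]. A factor with [j = k i]
    occurs exactly when some [k i < m i]; otherwise all indices are at most [d], where [a] is
    injective. *)
Lemma newton_eval_neq0 (m k : 'X_{1..n}) : (mdeg k <= d)%N ->
  ((newton m).@[fun i => a (k i)] != 0) = (m <= k)%MM.
Proof.
move=> k_d; have k_le i : (k i <= d)%N.
  by rewrite (leq_trans _ k_d) // mdegE (bigD1 i) //= leq_addr.
have -> : (newton m).@[fun i => a (k i)] =
    \prod_(i < n) \prod_(j < m i) (a (k i) - a j).
  rewrite rmorph_prod; apply: eq_bigr => i _ /=.
  rewrite rmorph_prod; apply: eq_bigr => j _ /=.
  by rewrite mevalB mevalXU mevalC.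
apply/prodf_neq0/mnm_lepP => [nz i|mk i _].
  have := nz i isT; apply: contraNleq => ki_mi.
  by apply/prodf_eq0; exists (Ordinal ki_mi) => //=; rewrite subrr.
apply/prodf_neq0 => j _; rewrite subr_eq0.
have j_k := leq_trans (ltn_ord j) (mk i).
apply/eqP => /a_inj; rewrite !inE k_le (leq_trans (ltnW j_k)) //.
by move=> /(_ isT isT) kj; rewrite kj ltnn in j_k.
Qed.

Definition newton_mx : 'M[K]_#|{: 'X_{1..n < d.+1}}| :=
  \matrix_(i, j) (newton (enum_val i : 'X_{1..n < d.+1})).@[
    fun l => a ((enum_val j : 'X_{1..n < d.+1}) l)].

Lemma newton_mx_unit : newton_mx \in unitmx.
Proof.
rewrite -row_free_unit; apply: inj_row_free => v vM0.
apply: contrapT => /eqP/rV0Pn[i0 nz_i0].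
pose deg (i : 'I_#|{: 'X_{1..n < d.+1}}|) :=
  mdeg (enum_val i : 'X_{1..n < d.+1}).
(* Minimal degree in the support of [v] replaces a triangular ordering: in column [i] only exponents
   below that of [i] contribute, and by minimality only [i] itself remains. *)
case: (@arg_minnP _ i0 (fun i => v 0 i != 0) deg nz_i0) => i nz_i min_i.
have := congr1 (fun w : 'rV_ _ => w 0 i) vM0; rewrite !mxE (bigD1 i) //=.
have di : (mdeg (enum_val i : 'X_{1..n < d.+1}) <= d)%N by rewrite -ltnS bmdeg.
rewrite big1 => [|j ji]; last first.
  apply/eqP; rewrite mulf_eq0 mxE -implyNb; apply/implyP => nz_j.
  apply: contraNT ji; rewrite newton_eval_neq0 // => ji_le.
  have := min_i _ nz_j; rewrite /deg => ij_deg.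
  apply/eqP/enum_val_inj/val_inj; exact: lepm_mdeg_eq ji_le ij_deg.
rewrite addr0 => /eqP; rewrite mxE mulf_eq0 (negPf nz_i) /=.
by apply/negP; rewrite newton_eval_neq0 //; apply/mnm_lepP.
Qed.

Lemma exists_dual_basis : exists L : 'X_{1..n < d.+1} -> {mpoly K[n]},
  (forall m, msize (L m) <= d.+1)%N /\
  forall m k : 'X_{1..n < d.+1}, (L m).@[fun i => a (k i)] = (m == k)%:R.
Proof.
(* The rows of the inverse matrix serve as Newton coordinates, so duality is the identity
   [invmx newton_mx *m newton_mx = 1]. *)
exists (fun m => \sum_j invmx newton_mx (enum_rank m) j *:
  newton (enum_val j : 'X_{1..n < d.+1})).
split=> [m|m k].
  apply: leq_trans (msize_sum _ _ _) _; apply/bigmax_leqP => i _.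
  rewrite (leq_trans (msizeZ_le _ _)) // (leq_trans (msize_newton _)) //.
  exact: bmdeg.
have := congr1 (fun A : 'M_ _ => A (enum_rank m) (enum_rank k))
  (mulVmx newton_mx_unit).
rewrite !mxE (inj_eq enum_rank_inj) => <-; rewrite raddf_sum.
by apply: eq_bigr => j _; rewrite /= mevalZ mxE enum_rankK.
Qed.

End Polynomials.

Lemma sharp_minimal_generating_set (K : fieldType) (n d : nat) :
  `I_d.+1 #<= [set: K] ->
  exists S : set {mpoly K[n]},
    [/\ minimal_generating_set S, degrees_le d S & S #= `I_('C(n + d, d))].
Proof.
move=> /ord_card_leP[a a_inj _].
(* Extending [a] to all naturals by [inord] keeps injectivity only up to [d], which is all that the
   interpolation asks for. *)
have a_injn : {in [pred k | (k <= d)%N] &, injective (fun k => a (inord k))}.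
  move=> k l /= kd ld /a_inj/(congr1 (@nat_of_ord _)); rewrite !inordK //.
have [L [Ld Lpt]] := exists_dual_basis n a_injn.
have [minL cardL] := dual_minimal_generating_set Lpt.
by exists (range L); split=> // [_ [m _ <-]//|]; rewrite -card_bmultinom.
Qed.

Theorem theorem1p2 (K : fieldType) (n d : nat) (hn : (1 <= n)%N) :
  [/\ forall S : set {mpoly K[n]},
        minimal_generating_set S -> degrees_le d S ->
        S #<= `I_('C(n + d, d)),
      `I_d.+1 #<= [set: K] ->
        exists S : set {mpoly K[n]},
          [/\ minimal_generating_set S, degrees_le d S
            & S #= `I_('C(n + d, d))]
    & infinite_set [set: K] ->
        exists S : set {mpoly K[n]},
          [/\ minimal_generating_set S, degrees_le d S
            & S #= `I_('C(n + d, d))] ].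
Proof.
split.
- exact: minimal_generating_set_card_le.
- exact: sharp_minimal_generating_set.
(* Failing to have [d + 1] elements would bound [K] by [d] and make it finite. *)
move=> infK; apply: sharp_minimal_generating_set; apply: not_card_le_ord => Kd.
apply: infK; exact: card_le_finite Kd (finite_II _).
Qed.
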